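(* For any prime $p\geq 5$ and any nonnegative integers $k$, $s$, $$\binom{kp}{sp}_q\equiv\binom{k}{s}_{q^{p^2}}-\binom{k}{s+1}\binom{s+1}{2}\frac{p^2-1}{12}(q^p-1)^2 \pmod{[p]_q^3}.$$
   Context: Here $q$ is an indeterminate. For a nonnegative integer $n$, $[n]_q := 1+q+\cdots+q^{n-1}=\frac{1-q^n}{1-q}$ (so $[0]_q=0$), and $[n]!_q := [n]_q[n-1]_q\cdots[1]_q$ (with $[0]!_q=1$). The $q$-binomial coefficient is $\binom{n}{m}_q := \frac{[n]!_q}{[m]!_q\,[n-m]!_q}$ for $0\le m\le n$, and $\binom{n}{m}_q:=0$ for $m>n$; it is a polynomial in $q$ with integer coefficients. $\binom{n}{m}_{q^{p^2}}$ denotes the polynomial obtained from $\binom{n}{m}_q$ by substituting $q^{p^2}$ for $q$. Binomial coefficients without subscript are the ordinary ones (zero when the lower index exceeds the upper). For polynomials $A,B\in\mathbb{Z}[q]$, $A\equiv B \pmod{[p]_q^3}$ means that $[p]_q^3$ divides $A-B$ in $\mathbb{Z}[q]$; note that $\frac{p^2-1}{12}$ is an integer for every prime $p\ge 5$. *)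

(* Defs.v *)
From mathcomp Require Import all_boot all_order all_algebra ring.

Set Implicit Arguments.
Unset Strict Implicit.
Unset Printing Implicit Defensive.

Import GRing.Theory.
Local Open Scope ring_scope.

(* Z[q] is {poly int}, with the indeterminate q written 'X. *)

Definition qnum (n : nat) : {poly int} := \sum_(i < n) 'X^i.

Definition qfact (n : nat) : {poly int} := \prod_(1 <= i < n.+1) qnum i.

(* [%/] is polynomial pseudo-division; here the divisor is monic and the
   division is exact: see [qbinom_fact]. *)
Definition qbinom (n m : nat) : {poly int} :=
  if (m <= n)%N then qfact n %/ (qfact m * qfact (n - m)) else 0.

(* Divisibility of A - B by D in Z[q] itself: the [%|] of polydiv on
   {poly int} only asks that D divide a nonzero integer multiple of A - B. *)
Definition eqmod_poly (D A B : {poly int}) : Prop :=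
  exists C : {poly int}, A - B = C * D.

Lemma qnum_monic n : (0 < n)%N -> qnum n \is monic.
Proof.
move=> n_gt0; rewrite -(monicMl _ (monicXsubC 1)) polyC1 -subrX1 -polyC1.
exact: monicXnsubC.
Qed.

Lemma qnumD m n : qnum (m + n) = qnum m + 'X^m * qnum n.
Proof.
rewrite /qnum big_split_ord mulr_sumr; congr (_ + _).
by apply: eq_bigr => i _; rewrite -exprD.
Qed.

Lemma qfactS n : qfact n.+1 = qfact n * qnum n.+1.
Proof. by rewrite /qfact big_nat_recr. Qed.

Lemma qfact0 : qfact 0 = 1.
Proof. by rewrite /qfact big_nil. Qed.

Lemma qfact_monic n : qfact n \is monic.
Proof.
elim: n => [|n IHn]; first by rewrite qfact0 monic1.
by rewrite qfactS monicMl ?qnum_monic.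
Qed.

Lemma qfact_dvd n m : (m <= n)%N ->
  exists Q : {poly int}, qfact n = Q * (qfact m * qfact (n - m)).
Proof.
elim: n m => [|n IHn] [|m] le_mn //.
- by exists 1; rewrite qfact0 !mul1r.
- by exists 1; rewrite subn0 qfact0 !mul1r.
have [Q1 E1] := IHn m le_mn; rewrite subSS qfactS.
have -> : n.+1 = (m.+1 + (n - m))%N by rewrite addSn subnKC.
rewrite qnumD mulrDr {1}E1 [qfact m.+1]qfactS.
have := le_mn; rewrite ltnS leq_eqVlt => /predU1P[-> | lt_mn].
  exists Q1; rewrite subnn /qnum big_ord0; ring.
have [Q2 E2] := IHn m.+1 lt_mn.
exists (Q1 + 'X^(m.+1) * Q2); rewrite E2 qfactS.
have -> : (n - m = (n - m.+1).+1)%N by rewrite subnSK.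
rewrite !qfactS; ring.
Qed.

Lemma qbinom_fact n m : (m <= n)%N ->
  qbinom n m * (qfact m * qfact (n - m)) = qfact n.
Proof.
move=> le_mn; rewrite /qbinom le_mn; have [Q ->] := qfact_dvd le_mn.
by rewrite Pdiv.IdomainMonic.mulpK // monicMl ?qfact_monic.
Qed.

(* Main.v *)
Require Import Defs.
From mathcomp Require Import all_boot all_order all_algebra all_field ring zify.

Set Implicit Arguments.
Unset Strict Implicit.
Unset Printing Implicit Defensive.

(** The proof goes by induction on [k], comparing the q-Vandermonde expansion of
    [qbinom (k * p + p) (s.+1 * p)], which has terms indexed by [0 <= j <= p],
    with the q-Pascal rule for [qbinom k.+1 s.+1] at q^(p^2).

    The terms [j = 0] and [j = p] are [qbinom (k * p) (s.+1 * p)] and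
    [qbinom (k * p) (s * p)] times q^(p^2 (k - s)): exactly the two terms of the
    q-Pascal rule, after substitution of q^(p^2).

    A term with [0 < j < p] is a product of two q-binomials with an upper index
    divisible by p and a lower one that is not, and each of these is a multiple
    of [p]_q ([qbinom_prime_dvd]).  Hence it is enough to know the first factor
    modulo [p]_q^2, and the same expansion gives it
    ([qbinom_prime_mul_add]): modulo [p]_q^2,
    [qbinom (k * p) (s * p + i)] is (s+1) C(k,s+1) times [qbinom p i].  Modulo
    [p]_q^3 the middle terms then add up to

      (s+1) C(k,s+1) * sum_(0 < j < p) qbinom(p,j)^2 q^(j^2),

    and the whole theorem comes down to the value of this last sum, which no
    longer involves k and s and is found in [sum_sqr_qbinom_prime] to be
    - (p^2-1)/12 (q^p - 1)^2.  The identity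

      C(k+1,s+2) C(s+2,2) =
        C(k,s+2) C(s+2,2) + C(k,s+1) C(s+1,2) + (s+1) C(k,s+1)

    closes the induction.

    To find the sum, divide it by [p]_q^2; what remains is a congruence modulo
    [p]_q, which can be tested by evaluation at the primitive p-th roots of unity
    z ([eqmod_qnum_roots]).  There, qbinom(p,j)/[p]_q takes the value
    qbinom(p-1,j-1)/[j]_q, with numerator +- z^(-j(j-1)/2)
    ([poly_eval_qbinom_pred]), so that the sum becomes (1-z)^2 times that of the
    z^j/(1-z^j)^2.  When w^p = 1 and w <> 1, w/(1-w)^2 is 1/(2p) times the
    polynomial sum_i i(p-i) w^i ([unity_root_quadratic]), and adding over w = z^j
    replaces every power w^i, i > 0, by -1 ([sum_inv_sqr_prim]). *)

Import GRing.Theory Num.Theory.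
Local Open Scope ring_scope.

(** * Congruences between integer polynomials *)

Section Congruence.

Implicit Types A B C D E : {poly int}.

Lemma eqmod_refl D A : eqmod_poly D A A.
Proof. by exists 0; rewrite subrr mul0r. Qed.

Lemma eqmod_trans D A B C :
  eqmod_poly D A B -> eqmod_poly D B C -> eqmod_poly D A C.
Proof.
by move=> [U hU] [V hV]; exists (U + V); rewrite mulrDl -hU -hV; ring.
Qed.

Lemma eqmodD D A A' B B' :
  eqmod_poly D A A' -> eqmod_poly D B B' -> eqmod_poly D (A + B) (A' + B').
Proof.
by move=> [U hU] [V hV]; exists (U + V); rewrite mulrDl -hU -hV; ring.
Qed.

Lemma eqmod_sum D (I : finType) (F G : I -> {poly int}) :
  (forall i, eqmod_poly D (F i) (G i)) ->
  eqmod_poly D (\sum_i F i) (\sum_i G i).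
Proof.
move=> h; apply: (big_ind2 (eqmod_poly D)) => //; first exact: eqmod_refl.
by move=> A A' B B'; apply: eqmodD.
Qed.

Lemma eqmod_sum0 D (I : finType) (F : I -> {poly int}) :
  (forall i, eqmod_poly D (F i) 0) -> eqmod_poly D (\sum_i F i) 0.
Proof.
by move=> h; have := @eqmod_sum D I F (fun=> 0) h; rewrite [\sum__ 0]big1.
Qed.

Lemma eqmodMl D C A B : eqmod_poly D A B -> eqmod_poly D (C * A) (C * B).
Proof. by move=> [U hU]; exists (C * U); rewrite -mulrA -hU; ring. Qed.

Lemma eqmodMr D C A B : eqmod_poly D A B -> eqmod_poly D (A * C) (B * C).
Proof. by rewrite ![_ * C]mulrC; apply: eqmodMl. Qed.

Lemma eqmod0Ml D C A : eqmod_poly D A 0 -> eqmod_poly D (C * A) 0.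
Proof. by move/(eqmodMl C); rewrite mulr0. Qed.

(** Moduli accumulate: a factor already divisible by [D] turns a congruence
    modulo [E] into one modulo [D * E].  This is how congruences modulo [p]_q
    give rise to congruences modulo its square and its cube. *)
Lemma eqmodM0 D E A B C :
  eqmod_poly D C 0 -> eqmod_poly E A B -> eqmod_poly (D * E) (C * A) (C * B).
Proof.
move=> [U]; rewrite subr0 => -> [V hV]; exists (U * V).
by rewrite -mulrBr hV; ring.
Qed.

End Congruence.

(** * Recurrences for q-binomial coefficients *)

Section QBinomial.

Implicit Types n m r j : nat.

Lemma qbinom_small n m : (n < m)%N -> qbinom n m = 0.
Proof. by rewrite /qbinom ltnNge => /negPf ->. Qed.

Lemma qbinom_uniq n m (Q : {poly int}) : (m <= n)%N ->
  Q * (qfact m * qfact (n - m)) = qfact n -> qbinom n m = Q.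
Proof.
move=> le_mn; rewrite -(qbinom_fact le_mn) => /esym; apply: mulIf.
by rewrite mulf_neq0 ?monic_neq0 ?qfact_monic.
Qed.

Lemma qbinom0 n : qbinom n 0 = 1.
Proof. by apply: qbinom_uniq; rewrite // subn0 qfact0 !mul1r. Qed.

Lemma qbinomnn n : qbinom n n = 1.
Proof. by apply: qbinom_uniq; rewrite // subnn qfact0 mulr1 mul1r. Qed.

Lemma qbinom_sub n m : (m <= n)%N -> qbinom n (n - m) = qbinom n m.
Proof.
move=> le_mn; apply: qbinom_uniq; rewrite ?leq_subr // subKn //.
by rewrite [qfact (n - m) * _]mulrC qbinom_fact.
Qed.

Lemma qbinomS n m :
  qbinom n.+1 m.+1 = qbinom n m.+1 + 'X^(n - m) * qbinom n m.
Proof.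
have [lt_nm | le_mn] := ltnP n m.
  by rewrite !qbinom_small ?mulr0 ?addr0 // ltnW.
apply: qbinom_uniq => //; rewrite subSS.
have := le_mn; rewrite leq_eqVlt => /predU1P[-> | lt_mn].
  by rewrite qbinom_small // subnn qbinomnn qfact0 !mulr1 add0r mul1r.
have E1 := qbinom_fact le_mn; have E2 := qbinom_fact lt_mn.
rewrite [RHS]qfactS; have -> : n.+1 = (n - m + m.+1)%N by lia.
rewrite qnumD mulrDr -{1}E2 -E1.
have -> : (n - m = (n - m.+1).+1)%N by lia.
by rewrite !qfactS; ring.
Qed.

Lemma qbinom_absorb n m :
  qbinom n.+1 m.+1 * qnum m.+1 = qnum n.+1 * qbinom n m.
Proof.
have [lt_nm | le_mn] := ltnP n m.
  by rewrite !qbinom_small ?mulr0 ?mul0r.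
apply: (@mulIf _ (qfact m * qfact (n - m))).
  by rewrite mulf_neq0 ?monic_neq0 ?qfact_monic.
rewrite -[RHS]mulrA qbinom_fact // mulrC [RHS]mulrC -qfactS.
have := @qbinom_fact n.+1 m.+1 le_mn; rewrite subSS => <-.
by rewrite qfactS; ring.
Qed.

(** Induction on [n] by the Pascal rule in its form with q^(n - j), which sends
    the two halves of the sum exactly to the expansions of [(m + n, r.+1)] and
    [(m + n, r)].  The test [j <= r] discards the terms in which truncation would
    turn the negative lower index [r - j] into 0; truncation of
    [m - (r - j)] is harmless, as [qbinom m (r - j)] is then 0. *)
Lemma qbinom_Vandermonde m n r :
  qbinom (m + n) r =
  \sum_(j < n.+1) if (j <= r)%N then
     qbinom m (r - j) * qbinom n j * 'X^(j * (m - (r - j))) else 0.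
Proof.
elim: n r => [|n IHn] r.
  by rewrite big_ord1 addn0 subn0 qbinomnn !mulr1.
rewrite big_ord_recl /= mul0n expr0 mulr1 subn0 qbinom0 mulr1.
case: r => [|r]; first by rewrite qbinom0 big1 ?addr0 ?qbinom0.
rewrite addnS qbinomS [in LHS]IHn big_ord_recl /= subn0 qbinom0 !mulr1.
rewrite -addrA; congr (_ + _).
transitivity (\sum_(j < n.+1) ((if (j <= r)%N then qbinom m (r - j) *
    qbinom n j.+1 * 'X^(j.+1 * (m - (r - j))) else 0) +
   'X^(m + n - r) * if (j <= r)%N then
     qbinom m (r - j) * qbinom n j * 'X^(j * (m - (r - j))) else 0)).
  rewrite big_split -mulr_sumr -IHn; congr (_ + _).
  rewrite big_ord_recr /= (@qbinom_small n n.+1) // mulr0 mul0r if_same addr0.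
  by apply: eq_bigr => j _; rewrite /bump add1n ltnS subSS.
apply: eq_bigr => j _; rewrite /bump /= add1n ltnS subSS.
case: ifP => le_jr; last by rewrite mulr0 addr0.
rewrite qbinomS.
have [lt_m | le_m] := ltnP m (r - j).
  by rewrite (qbinom_small lt_m); ring.
have le_jn : (j <= n)%N by rewrite -ltnS.
have -> : 'X^(m + n - r) * (qbinom m (r - j) * qbinom n j
    * 'X^(j * (m - (r - j)))) = qbinom m (r - j) *
    ('X^(n - j) * qbinom n j) * 'X^(j.+1 * (m - (r - j))) :> {poly int}.
  have -> : 'X^(j.+1 * (m - (r - j))) =
      'X^(m - (r - j)) * 'X^(j * (m - (r - j))) :> {poly int}.
    by rewrite mulSn exprD.
  have -> : (m + n - r = (m - (r - j)) + (n - j))%N by lia.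
  by rewrite exprD; ring.
by ring.
Qed.

End QBinomial.

(** * Evaluation at roots of unity *)

Section RootsOfUnity.

Definition poly_eval (z : algC) : {rmorphism {poly int} -> algC} :=
  horner_eval z \o map_poly intr.

Lemma poly_evalE z P : poly_eval z P = (map_poly intr P).[z].
Proof. by []. Qed.

Lemma poly_evalX z n : poly_eval z 'X^n = z ^+ n.
Proof. by rewrite poly_evalE map_polyXn hornerXn. Qed.

Lemma poly_eval_qnum z n : (z - 1) * poly_eval z (qnum n) = z ^+ n - 1.
Proof.
rewrite subrX1 /qnum rmorph_sum; congr (_ * _).
by apply: eq_bigr => i _; rewrite poly_evalX.
Qed.

Lemma size_qnum n : (0 < n)%N -> size (qnum n) = n.
Proof.
case: n => // n _.
have := size_Mmonic (monic_neq0 (monicXsubC (1 : int))) (@qnum_monic n.+1 isT).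
by rewrite polyC1 -subrX1 size_XsubC size_XnsubC // => -[].
Qed.

Lemma expr_prim_neq1 (R : nzRingType) n (z : R) j :
  n.-primitive_root z -> (0 < j < n)%N -> z ^+ j != 1.
Proof.
by move=> z_prim /andP[j_gt0 lt_jn]; rewrite -(prim_order_dvd z_prim) gtnNdvd.
Qed.

Lemma sum_by_parts (R : comNzRingType) (w : R) (a : nat -> R) n :
  (1 - w) * \sum_(i < n) a i * w ^+ i =
  a 0%N - a n * w ^+ n + w * \sum_(i < n) (a i.+1 - a i) * w ^+ i.
Proof.
elim: n => [|n IHn]; first by rewrite !big_ord0 expr0; ring.
by rewrite !big_ord_recr /= mulrDr IHn exprS; ring.
Qed.

Lemma sum_unity_root (w : algC) n : w ^+ n = 1 -> w != 1 ->
  \sum_(i < n) w ^+ i = 0.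
Proof.
move=> wn1 w_neq1; apply: (@mulfI _ (w - 1)); first by rewrite subr_eq0.
by rewrite -subrX1 wn1 subrr mulr0.
Qed.

(** Two summations by parts: [i * (n - i)] vanishes at both ends of the period
    and its second difference is the constant -2, whose sum against the powers
    of [w] is 0.  Only the boundary terms of the second step survive; they add
    up to 2n. *)
Lemma unity_root_quadratic (w : algC) n : w ^+ n = 1 -> w != 1 ->
  (1 - w) ^+ 2 * \sum_(i < n) (i%:R * (n%:R - i%:R)) * w ^+ i = 2%:R * n%:R * w.
Proof.
move=> wn1 w_neq1; rewrite expr2 -mulrA.
rewrite (sum_by_parts w (fun i => i%:R * (n%:R - i%:R))) mulrDr.
under eq_bigr => i _.
  have -> : i.+1%:R * (n%:R - i.+1%:R) - i%:R * (n%:R - i%:R)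
      = n%:R - 1 - 2%:R * i%:R :> algC by rewrite -[i.+1]addn1 natrD; ring.
  over.
rewrite mulrCA (sum_by_parts w (fun i => n%:R - 1 - 2%:R * i%:R)).
under eq_bigr => i _.
  have -> : n%:R - 1 - 2%:R * i.+1%:R - (n%:R - 1 - 2%:R * i%:R)
      = - 2%:R :> algC by rewrite -[i.+1]addn1 natrD; ring.
  over.
by rewrite -mulr_sumr sum_unity_root // wn1; ring.
Qed.

Lemma sum_quadratic n :
  6%:R * \sum_(i < n) (i%:R * (n%:R - i%:R)) = n%:R * (n%:R ^+ 2 - 1) :> algC.
Proof.
(* The parameter n of the summand is freed, so that induction on the number of
   terms is possible. *)
suff H m x : 6%:R * \sum_(i < m) (i%:R * (x - i%:R)) =
    m%:R * (m%:R - 1) * (3%:R * x - 2%:R * m%:R + 1) :> algC by rewrite H; ring.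
elim: m => [|m IHm]; first by rewrite big_ord0; ring.
by rewrite big_ord_recr /= mulrDr IHm -[m.+1]addn1 natrD; ring.
Qed.

Variables (p : nat) (p_prime : prime p).

(** The remainder of [P] by the monic [qnum p] has degree less than p - 1 and
    vanishes at the p - 1 primitive roots, so it is 0.  Asking for all primitive
    roots at once spares the irreducibility of [qnum p]. *)
Lemma eqmod_qnum_roots P :
  (forall z : algC, p.-primitive_root z -> poly_eval z P = 0) ->
  eqmod_poly (qnum p) P 0.
Proof.
move=> P0; have p_gt0 := prime_gt0 p_prime.
have q_monic := qnum_monic p_gt0; have := Pdiv.IdomainMonic.divp_eq q_monic P.
set Q := P %/ _; set R := P %% _ => defP.
have lt_R : (size R < p)%N.
  by rewrite -[X in (_ < X)%N](size_qnum p_gt0) ltn_modp monic_neq0.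
suff R0 : R = 0 by exists Q; rewrite subr0 {1}defP R0 addr0.
apply/eqP; apply: contraTT lt_R => R_neq0.
have [z z_prim] := C_prim_root_exists p_gt0.
have zi_prim i : i \in iota 1 p.-1 -> p.-primitive_root (z ^+ i).
  rewrite mem_iota => lt_i; rewrite prim_root_exp_coprime // coprime_sym.
  by rewrite prime_coprime // gtnNdvd //; lia.
have := @max_poly_roots _ (map_poly intr R) [seq z ^+ i | i <- iota 1 p.-1].
rewrite size_map size_iota (size_map_inj_poly intr_inj) //.
rewrite prednK // leqNgt; apply.
- by rewrite map_poly_eq0_id0 ?lead_coef_eq0 // intr_eq0 lead_coef_eq0.
- apply/allP => _ /mapP[i /zi_prim zi ->]; apply/eqP; rewrite -poly_evalE.
  have := P0 _ zi; rewrite defP rmorphD rmorphM.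
  have /eqP := poly_eval_qnum (z ^+ i) p.
  rewrite (prim_expr_order zi) subrr mulf_eq0 subr_eq0.
  have -> : (z ^+ i == 1) = false.
    by rewrite -[z ^+ i]expr1 -(prim_order_dvd zi) gtnNdvd // prime_gt1.
  by move/eqP->; rewrite mulr0 add0r.
rewrite map_inj_in_uniq ?iota_uniq // => i j; rewrite !mem_iota => hi hj /eqP.
by rewrite (eq_prim_root_expr z_prim) !modn_small; [move/eqP|lia|lia].
Qed.

Variables (z : algC) (z_prim : p.-primitive_root z).

Let p_gt0 : (0 < p)%N := prime_gt0 p_prime.

Let p_neq0 : p%:R != 0 :> algC.
Proof. by rewrite pnatr_eq0 -lt0n. Qed.

Lemma poly_eval_qnum_eq0 n : (poly_eval z (qnum n) == 0) = (p %| n)%N.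
Proof.
have z_neq1 : z - 1 != 0.
  by rewrite subr_eq0 -[z]expr1 (expr_prim_neq1 z_prim) // prime_gt1.
rewrite (prim_order_dvd z_prim) -[RHS]subr_eq0 -poly_eval_qnum.
by rewrite mulf_eq0 (negPf z_neq1).
Qed.

(** In [qbinom n r * qnum r = qnum n * qbinom n.-1 r.-1] the factor [qnum n]
    vanishes at [z] and [qnum r] does not. *)
Lemma poly_eval_qbinom_eq0 n r : (p %| n)%N -> ~~ (p %| r)%N ->
  poly_eval z (qbinom n r) = 0.
Proof.
case: r => [|r]; first by rewrite dvdn0.
case: n => [|n] p_n p_r; first by rewrite qbinom_small // rmorph0.
rewrite -poly_eval_qnum_eq0 in p_r; apply: (mulIf p_r).
rewrite mul0r -rmorphM qbinom_absorb rmorphM.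
by rewrite (eqP (_ : poly_eval z _ == 0)) ?mul0r // poly_eval_qnum_eq0.
Qed.

(** As [qbinom p m.+1] vanishes at [z], the Pascal rule gives the ratio
    - z^(p-1-m) = - z^(-(m+1)) of two successive values, so that the m-th value
    is (-1)^m z^(-m(m+1)/2).  Squaring removes the sign and the halved
    exponent. *)
Lemma poly_eval_qbinom_pred m : (m < p)%N ->
  poly_eval z (qbinom p.-1 m) ^+ 2 * z ^+ (m * m.+1) = 1.
Proof.
elim: m => [|m IHm] lt_mp; first by rewrite qbinom0 rmorph1 mul0n; ring.
have : poly_eval z (qbinom p.-1.+1 m.+1) == 0.
  by rewrite poly_eval_qbinom_eq0 ?prednK // gtnNdvd.
rewrite qbinomS rmorphD rmorphM poly_evalX addr_eq0 => /eqP->.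
rewrite sqrrN.
have -> : (m.+1 * m.+2 = m * m.+1 + (m.+1 + m.+1))%N by lia.
have zp : z ^+ (p.-1 - m) * z ^+ m.+1 = 1.
  rewrite -exprD -[RHS](prim_expr_order z_prim); congr (_ ^+ _); lia.
transitivity ((z ^+ (p.-1 - m) * z ^+ m.+1) ^+ 2 *
    (poly_eval z (qbinom p.-1 m) ^+ 2 * z ^+ (m * m.+1))).
  by rewrite !exprD; ring.
by rewrite zp IHm ?(ltnW lt_mp) // mulr1 expr1n.
Qed.

(** By [unity_root_quadratic] each term is 1/(2p) sum_i i(p-i) z^(ji).  The
    power sums over 0 < j < p are all -1, except at i = 0 where the coefficient
    vanishes; so the total is -1/(2p) sum_i i(p-i) = - (p^2-1)/12. *)
Lemma sum_inv_sqr_prim :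
  12%:R * \sum_(j < p.-1) z ^+ j.+1 / (1 - z ^+ j.+1) ^+ 2
  = 1 - p%:R ^+ 2 :> algC.
Proof.
have two_p : 2%:R * p%:R != 0 :> algC by rewrite mulf_neq0 // pnatr_eq0.
have quad (j : 'I_p.-1) : z ^+ j.+1 / (1 - z ^+ j.+1) ^+ 2 =
    (2%:R * p%:R)^-1 *
      \sum_(i < p) (i%:R * (p%:R - i%:R)) * (z ^+ j.+1) ^+ i.
  have w_neq1 : z ^+ j.+1 != 1.
    by apply: (expr_prim_neq1 z_prim); have := ltn_ord j; lia.
  have wp : (z ^+ j.+1) ^+ p = 1.
    by rewrite exprAC (prim_expr_order z_prim) expr1n.
  have d_neq0 : (1 - z ^+ j.+1) ^+ 2 != 0.
    by rewrite expf_neq0 // subr_eq0 eq_sym.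
  apply: (mulfI two_p); rewrite mulrA -(unity_root_quadratic wp w_neq1).
  by rewrite mulrAC mulfV // mul1r mulrA mulfV // mul1r.
under eq_bigr do rewrite quad.
rewrite -mulr_sumr exchange_big /=.
have -> : \sum_(i < p) \sum_(j < p.-1) i%:R * (p%:R - i%:R) * (z ^+ j.+1) ^+ i
    = - \sum_(i < p) (i%:R * (p%:R - i%:R)) :> algC.
  rewrite -sumrN; apply: eq_bigr => i _; rewrite -mulr_sumr -[RHS]mulrN1.
  have [->|i_gt0] := posnP i; first by rewrite mulr0n !mul0r.
  congr (_ * _); have zi : z ^+ i != 1.
    by rewrite (expr_prim_neq1 z_prim) // i_gt0 ltn_ord.
  have zip : (z ^+ i) ^+ p.-1.+1 = 1.
    by rewrite prednK // exprAC (prim_expr_order z_prim) expr1n.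
  have := sum_unity_root zip zi; rewrite big_ord_recl expr0.
  move/eqP; rewrite addrC addr_eq0 => /eqP <-; apply: eq_bigr => j _.
  by rewrite exprAC.
have := sum_quadratic p; set S := \sum_(i < p) _ => hS.
have -> : 12%:R * ((2%:R * p%:R)^-1 * - S) = - (p%:R^-1 * (6%:R * S)).
  by field.
by rewrite hS mulrA mulVf // mul1r opprB.
Qed.

End RootsOfUnity.

(** * Congruences modulo powers of [p]_q *)

Section PrimeModulus.

Variables (p : nat) (p_prime : prime p).

Let p_gt0 : (0 < p)%N := prime_gt0 p_prime.

Lemma qbinom_prime_dvd n r : (p %| n)%N -> ~~ (p %| r)%N ->
  eqmod_poly (qnum p) (qbinom n r) 0.
Proof.
move=> p_n p_r; apply: eqmod_qnum_roots => // z z_prim.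
exact: poly_eval_qbinom_eq0 z_prim _ _ p_n p_r.
Qed.

Lemma ndvdn_ltn j : (0 < j < p)%N -> ~~ (p %| j)%N.
Proof. by case/andP=> j_gt0 lt_jp; rewrite gtnNdvd. Qed.

Lemma eqmod_expX_prime n : eqmod_poly (qnum p) 'X^(p * n) 1.
Proof.
exists (('X - 1) * \sum_(i < n) 'X^p ^+ i).
by rewrite exprM subrX1 [X in X * _ = _]subrX1 mulrAC.
Qed.

Lemma dvdn12_sqr_pred : (5 <= p)%N -> (12 * ((p ^ 2 - 1) %/ 12) = p ^ 2 - 1)%N.
Proof.
move=> p_ge5; rewrite mulnC divnK //.
have ndvd d : prime d -> (d < 5)%N -> (p %% d != 0)%N.
  move=> d_prime d_lt5; rewrite -/(dvdn d p) dvdn_prime2 //; lia.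
have := ndvd 2 isT isT; have := ndvd 3 isT isT.
rewrite (divn_eq p 12); set a := (p %/ 12)%N; have := @ltn_pmod p 12 isT.
move: (p %% 12)%N => r; move=> r_lt h3 h2.
have {}h3 : (r %% 3 != 0)%N by lia.
have {}h2 : (r %% 2 != 0)%N by lia.
have : (r = 1 \/ r = 5 \/ r = 7 \/ r = 11)%N by lia.
by case=> [|[|[|]]] ->; apply/dvdnP;
  [exists (12 * a ^ 2 + 2 * a)%N | exists (12 * a ^ 2 + 10 * a + 2)%N
  | exists (12 * a ^ 2 + 14 * a + 4)%N | exists (12 * a ^ 2 + 22 * a + 10)%N];
  lia.
Qed.

(** The case k = 2, s = 1 of the theorem in disguise: with its terms j = 0 and
    j = p the sum would be [qbinom (2 * p) p].  After division by [p]_q^2 it is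
    a congruence modulo [p]_q, where the value at a primitive root [z] of the
    j-th term is (z-1)^2 z^j/(1-z^j)^2. *)
Lemma sum_sqr_qbinom_prime : (5 <= p)%N ->
  eqmod_poly (qnum p ^+ 3)
    (\sum_(j < p.-1) qbinom p j.+1 ^+ 2 * 'X^(j.+1 ^ 2))
    (- ((p ^ 2 - 1) %/ 12)%N%:R * ('X^p - 1) ^+ 2).
Proof.
move=> p_ge5; set c := (_ %/ 12)%N.
have c12 : 12%:R * c%:R = p%:R ^+ 2 - 1 :> algC.
  by rewrite -natrM dvdn12_sqr_pred // natrB ?expn_gt0 ?p_gt0 // natrX.
have lt_ord (j : 'I_p.-1) : (0 < j.+1 < p)%N by have := ltn_ord j; lia.
(* [b] is the quotient of the q-binomial coefficients by [qnum p]. *)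
have /fin_all_exists[b def_b] (j : 'I_p.-1) :
    exists b, qbinom p j.+1 = b * qnum p.
  have [b] := qbinom_prime_dvd (dvdnn p) (ndvdn_ltn (lt_ord j)).
  by rewrite subr0; exists b.
have [|C hC] := @eqmod_qnum_roots p p_prime
    (\sum_(j < p.-1) b j ^+ 2 * 'X^(j.+1 ^ 2) + c%:R * ('X - 1) ^+ 2);
    last first.
  exists C; rewrite subr0 in hC.
  have -> : 'X^p - 1 = ('X - 1) * qnum p by rewrite subrX1.
  rewrite [RHS](_ : _ = (C * qnum p) * qnum p ^+ 2); last by ring.
  rewrite -hC [RHS]mulrDl mulr_suml mulNr opprK; congr (_ + _); last by ring.
  by apply: eq_bigr => j _; rewrite def_b; ring.
move=> z z_prim.
have term (j : 'I_p.-1) : poly_eval z (b j ^+ 2 * 'X^(j.+1 ^ 2)) =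
    (z - 1) ^+ 2 * (z ^+ j.+1 / (1 - z ^+ j.+1) ^+ 2).
  have absorb : b j * qnum j.+1 = qbinom p.-1 j.
    apply: (mulfI (monic_neq0 (qnum_monic p_gt0))).
    rewrite mulrA [qnum p * b j]mulrC -def_b.
    by have := qbinom_absorb p.-1 j; rewrite prednK.
  have sq1 := @poly_eval_qbinom_pred p p_prime z z_prim j.
  rewrite -absorb rmorphM in sq1.
  have d_neq0 : (1 - z ^+ j.+1) ^+ 2 != 0.
    by rewrite expf_neq0 // subr_eq0 eq_sym (expr_prim_neq1 z_prim).
  apply: (mulIf d_neq0); rewrite -[RHS]mulrA divfK //.
  rewrite -opprB sqrrN -poly_eval_qnum rmorphM rmorphXn poly_evalX.
  have -> : (j.+1 ^ 2 = j * j.+1 + j.+1)%N by lia.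
  rewrite exprD -[z ^+ j.+1 in RHS]mul1r -{}sq1; last by have := ltn_ord j; lia.
  by ring.
rewrite rmorphD rmorph_sum (eq_bigr _ (fun j _ => term j)) -mulr_sumr.
rewrite rmorphM rmorph_nat rmorphXn rmorphB rmorph1 -['X]expr1 poly_evalX expr1.
rewrite [c%:R * _]mulrC -mulrDr; apply/eqP; rewrite mulf_eq0; apply/orP; right.
have tw : 12%:R != 0 :> algC by rewrite pnatr_eq0.
rewrite -(inj_eq (mulfI tw)) mulrDr c12 (sum_inv_sqr_prim p_prime z_prim).
by rewrite mulr0 -opprB addNr.
Qed.

(** The expansion with its two end terms set apart: these are the only ones
    whose second factor [qbinom p j] is not a multiple of [qnum p]. *)
Lemma qbinom_split m r :
  qbinom (m + p) r = qbinom m r +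
    \sum_(j < p.-1) (if (j.+1 <= r)%N then
       qbinom m (r - j.+1) * qbinom p j.+1 * 'X^(j.+1 * (m - (r - j.+1)))
     else 0) +
    (if (p <= r)%N then qbinom m (r - p) * 'X^(p * (m - (r - p))) else 0).
Proof.
rewrite qbinom_Vandermonde -(@big_mkord _ _ _ p.+1 xpredT (fun j =>
  if (j <= r)%N then qbinom m (r - j) * qbinom p j * 'X^(j * (m - (r - j)))
  else 0)).
rewrite big_nat_recr //= -{1}(prednK p_gt0) big_nat_recl //= big_mkord.
by rewrite subn0 qbinom0 qbinomnn mul0n !mulr1.
Qed.

(** Modulo [p]_q only the end terms of the expansion remain, and q^p is 1: what
    is left is the ordinary Pascal rule. *)
Lemma qbinom_prime_mul k s :
  eqmod_poly (qnum p) (qbinom (k * p) (s * p)) 'C(k, s)%:R.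
Proof.
elim: k s => [|k IHk] [|s].
- by rewrite qbinom0; apply: eqmod_refl.
- by rewrite qbinom_small ?muln_gt0 ?p_gt0 //; apply: eqmod_refl.
- by rewrite mul0n qbinom0 bin0; apply: eqmod_refl.
rewrite [(k.+1 * p)%N]mulSnr qbinom_split.
have -> : (p <= s.+1 * p)%N by rewrite leq_pmull.
have -> : (s.+1 * p - p = s * p)%N by rewrite mulSn addKn.
rewrite binS natrD; apply: eqmodD; last first.
  rewrite -[X in eqmod_poly _ _ X]mulr1.
  exact: eqmod_trans (eqmodMr _ (IHk s)) (eqmodMl _ (eqmod_expX_prime _)).
rewrite -[X in eqmod_poly _ _ X]addr0; apply: eqmodD => //.
apply: eqmod_sum0 => j; case: ifP => _; last exact: eqmod_refl.
have lt_j : (0 < j.+1 < p)%N by have := ltn_ord j; lia.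
rewrite mulrAC; apply: eqmod0Ml.
exact: qbinom_prime_dvd (dvdnn p) (ndvdn_ltn lt_j).
Qed.

(** Modulo [p]_q^2 three terms of the expansion remain: both ends, given by
    the induction hypothesis, and [j = i], where the lower index [s * p] makes
    the first factor C(k,s) modulo [p]_q.  The coefficients therefore satisfy
    a(k+1,s) = a(k,s) + C(k,s) + a(k,s-1), as (s+1) C(k,s+1) does. *)
Lemma qbinom_prime_mul_add k s i : (0 < i < p)%N ->
  eqmod_poly (qnum p ^+ 2) (qbinom (k * p) (s * p + i))
    ((s.+1 * 'C(k, s.+1))%N%:R * qbinom p i).
Proof.
move=> hi; have p_i := qbinom_prime_dvd (dvdnn p) (ndvdn_ltn hi).
elim: k s => [|k IHk] s.
  by rewrite muln0 mul0r qbinom_small ?addn_gt0; [apply: eqmod_refl | lia].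
rewrite [(k.+1 * p)%N]mulSnr qbinom_split.
have -> : (s.+1 * 'C(k.+1, s.+1))%:R = (s.+1 * 'C(k, s.+1))%:R
    + 'C(k, s)%:R + (s * 'C(k, s))%:R :> {poly int}.
  by rewrite -!natrD; congr _%:R; rewrite binS; lia.
rewrite !mulrDl; apply: eqmodD; last first.
  case: s => [|s].
    by rewrite leqNgt !mul0r; case/andP: hi => _ ->; apply: eqmod_refl.
  have -> : (p <= s.+1 * p + i)%N by lia.
  have -> : (s.+1 * p + i - p = s * p + i)%N by lia.
  apply: eqmod_trans (eqmodMr _ (IHk s)) _.
  rewrite -[X in eqmod_poly _ _ X]mulr1 -!mulrA; apply: eqmodMl.
  exact: eqmodM0 p_i (eqmod_expX_prime _).
apply: eqmodD; first exact: IHk.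
have -> : 'C(k, s)%:R * qbinom p i = \sum_(j < p.-1)
    (if j.+1 == i then 'C(k, s)%:R * qbinom p i else 0).
  have lt_i : (i.-1 < p.-1)%N by lia.
  rewrite (bigD1 (Ordinal lt_i)) //= prednK ?eqxx; last by lia.
  rewrite big1 ?addr0 // => j; rewrite -val_eqE /= => neq_j.
  by rewrite ifN //; lia.
apply: eqmod_sum => j; have lt_j : (0 < j.+1 < p)%N by have := ltn_ord j; lia.
have [-> | neq_ij] := eqVneq j.+1 i.
  rewrite leq_addl addnK [_ * qbinom p i]mulrC -mulrA.
  rewrite [X in eqmod_poly _ _ X]mulrC.
  apply: (eqmodM0 p_i); rewrite -[X in eqmod_poly _ _ X]mulr1.
  apply: eqmod_trans (eqmodMr _ (qbinom_prime_mul k s)) (eqmodMl _ _).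
  have -> : (i * (k * p - s * p) = p * (i * (k - s)))%N.
    by rewrite -mulnBl; lia.
  exact: eqmod_expX_prime.
case: ifP => le_j; last exact: eqmod_refl.
have p_j := qbinom_prime_dvd (dvdnn p) (ndvdn_ltn lt_j).
have p_r : ~~ (p %| s * p + i - j.+1)%N.
  apply: contraNN neq_ij => /dvdnP[q def_r]; apply/eqP.
  have /(congr1 (modn^~ p)) : (q * p + j.+1 = s * p + i)%N by lia.
  by rewrite !modnMDl !modn_small; lia.
have p_kr := qbinom_prime_dvd (dvdn_mull k (dvdnn p)) p_r.
have := eqmodMr 'X^(j.+1 * (k * p - (s * p + i - j.+1))) (eqmodM0 p_kr p_j).
by rewrite mulr0 mul0r.
Qed.

End PrimeModulus.

(** * The congruence modulo [p]_q^3 *)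

Theorem theorem3 (p k s : nat) (p_prime : prime p) (p_ge5 : (5 <= p)%N) :
  eqmod_poly (qnum p ^+ 3)
    (qbinom (k * p) (s * p))
    (qbinom k s \Po 'X^(p ^ 2)
     - 'C(k, s.+1)%:R * 'C(s.+1, 2)%:R * ((p ^ 2 - 1) %/ 12)%N%:R
       * ('X^p - 1) ^+ 2).
Proof.
have p_gt0 := prime_gt0 p_prime.
set c : {poly int} := (_ %/ 12)%N%:R; set Y := ('X^p - 1) ^+ 2.
elim: k s => [|k IHk] [|s].
- by rewrite !qbinom0 rmorph1 mulr0 !mul0r subr0; apply: eqmod_refl.
- rewrite !qbinom_small ?muln_gt0 ?p_gt0 // rmorph0 !mul0r subr0.
  exact: eqmod_refl.
- by rewrite !qbinom0 rmorph1 mulr0 !mul0r subr0; apply: eqmod_refl.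
rewrite [(k.+1 * p)%N]mulSnr qbinom_split //.
have -> : (p <= s.+1 * p)%N by rewrite leq_pmull.
have -> : (s.+1 * p - p = s * p)%N by rewrite mulSn addKn.
set t := (s.+1 * 'C(k, s.+1))%N.
(* [Y] is already divisible by [qnum p ^+ 2]. *)
have Ypow n : eqmod_poly (qnum p ^+ 3) (Y * 'X^(p * n)) Y.
  rewrite -[X in eqmod_poly _ _ X]mulr1 exprSr.
  apply: eqmodM0 (eqmod_expX_prime _ _).
  by exists (('X - 1) ^+ 2); rewrite subr0 /Y subrX1 exprMn.
have mid : eqmod_poly (qnum p ^+ 3)
    (\sum_(j < p.-1) (if (j.+1 <= s.+1 * p)%N then
       qbinom (k * p) (s.+1 * p - j.+1) * qbinom p j.+1
         * 'X^(j.+1 * (k * p - (s.+1 * p - j.+1))) else 0))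
    (- (t%:R * c * Y)).
  apply: eqmod_trans (_ : eqmod_poly _ _ (t%:R *
    \sum_(j < p.-1) qbinom p j.+1 ^+ 2 * 'X^(j.+1 ^ 2))) _; last first.
    have -> : - (t%:R * c * Y) = t%:R * (- c * Y) by ring.
    exact: eqmodMl (sum_sqr_qbinom_prime p_prime p_ge5).
  rewrite mulr_sumr; apply: eqmod_sum => j.
  have lt_j : (0 < j.+1 < p)%N by have := ltn_ord j; lia.
  have -> : (j.+1 <= s.+1 * p)%N by lia.
  have p_j := qbinom_prime_dvd p_prime (dvdnn p) (ndvdn_ltn lt_j).
  have lt_pj : (0 < p - j.+1 < p)%N by lia.
  have -> : (s.+1 * p - j.+1 = s * p + (p - j.+1))%N by lia.
  have := eqmodM0 p_j (qbinom_prime_mul_add p_prime k s lt_pj).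
  rewrite -exprS qbinom_sub; last by lia.
  move/(eqmodMr 'X^(j.+1 * (k * p - (s * p + (p - j.+1))))).
  rewrite [qbinom p j.+1 * qbinom (k * p) _]mulrC => /eqmod_trans; apply.
  (* The exponent of q is j^2 modulo p, unless its subtraction is truncated; but
     then k <= s and both sides are 0. *)
  have [le_ks | lt_sk] := leqP k s.
    by rewrite /t bin_small // muln0 !mul0r mulr0 mul0r; apply: eqmod_refl.
  have -> : (j.+1 * (k * p - (s * p + (p - j.+1))) =
      p * (j.+1 * (k - s.+1)) + j.+1 ^ 2)%N.
    have -> : (k * p - (s * p + (p - j.+1)) = (k - s.+1) * p + j.+1)%N.
      rewrite -{1}(subnKC lt_sk) mulnDl; move: (k - s.+1)%N => d; lia.
    lia.
  rewrite mulrCA -expr2 -mulrA; apply: eqmodMl; rewrite exprSr.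
  apply: eqmodM0.
    by have := eqmodM0 p_j p_j; rewrite mulr0 -!expr2.
  rewrite exprD -[X in eqmod_poly _ _ X]mul1r.
  exact/eqmodMr/eqmod_expX_prime.
rewrite qbinomS comp_polyD comp_polyM rmorphXn /= comp_polyX -exprM.
have -> : (p ^ 2 * (k - s) = p * (k * p - s * p))%N.
  by rewrite -mulnBl; lia.
set e := (p * _)%N.
have -> : qbinom k s.+1 \Po 'X^(p ^ 2) + 'X^e * (qbinom k s \Po 'X^(p ^ 2))
    - 'C(k.+1, s.+2)%:R * 'C(s.+2, 2)%:R * c * Y =
    (qbinom k s.+1 \Po 'X^(p ^ 2) - 'C(k, s.+2)%:R * 'C(s.+2, 2)%:R * c * Y)
    - t%:R * c * Y
    + ((qbinom k s \Po 'X^(p ^ 2)) * 'X^e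
       - 'C(k, s.+1)%:R * 'C(s.+1, 2)%:R * c * Y).
  rewrite /t binS [in 'C(s.+2, 2)]binS bin1 !natrD natrM; ring.
apply: eqmodD; first exact: eqmodD (IHk _) mid.
apply: eqmod_trans (eqmodMr _ (IHk s)) _; rewrite mulrBl.
apply: eqmodD; first exact: eqmod_refl.
rewrite -!mulNr -[X in eqmod_poly _ X _]mulrA.
exact/eqmodMl/Ypow.
Qed.
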